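(* Define $f_1(m_1,m_2)=33m_1+49m_2$ and, for every $t\geq 2$, $$f_t(m_1,m_2)=f_{t-1}\big(f_{t-1}(32m_1+49m_2,\,m_1+m_2-1),\,32m_1+49m_2\big).$$ Let $m_1,m_2$ and $n_1,\ldots,n_t$ be positive integers such that $m_2\geq n_i\geq 2\lceil \log (f_t(m_1,m_2))\rceil+2$ for each $1\leq i\leq t$. Then $$R(C_{n_1},\ldots,C_{n_t},K_{m_1,m_2})\leq f_t(m_1,m_2).$$
   Context: $C_k$ denotes the cycle on $k$ vertices and $K_{a,b}$ the complete bipartite graph with parts of sizes $a$ and $b$. For graphs $G_1,\ldots,G_k$, the Ramsey number $R(G_1,\ldots,G_k)$ is the smallest integer $N$ such that for every coloring of the edges of the complete graph $K_N$ with colors $1,\ldots,k$ there is, for some $i$, a copy of $G_i$ all of whose edges have color $i$. $\log$ denotes the logarithm to base $2$. *)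

(* Defs.v *)
From mathcomp Require Import all_boot.
Set Implicit Arguments. Unset Strict Implicit. Unset Printing Implicit Defensive.

(* f_aux k m1 m2 = f_{k+1}(m1,m2) of the paper. *)
Fixpoint f_aux (k m1 m2 : nat) : nat :=
  match k with
  | 0 => 33 * m1 + 49 * m2
  | k'.+1 => f_aux k' (f_aux k' (32 * m1 + 49 * m2) (m1 + m2 - 1))
                      (32 * m1 + 49 * m2)
  end.

Definition f (t m1 m2 : nat) : nat := f_aux t.-1 m1 m2.

Definition ceil_log2 (x : nat) : nat := up_log 2 x.

(* An edge-colouring of K_N with colours in nat: symmetric function on pairs
   of vertices (diagonal values are irrelevant). *)
Definition coloring (N : nat) := 'I_N -> 'I_N -> nat.

Definition symmetric_col N (c : coloring N) := forall u v, c u v = c v u.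

Definition has_mono_cycle N (c : coloring N) (n col : nat) : Prop :=
  exists v : 'I_n -> 'I_N, injective v /\
    forall j : 'I_n, c (v j) (v (ordS j)) = col.

Definition has_mono_Kab N (c : coloring N) (a b col : nat) : Prop :=
  exists (x : 'I_a -> 'I_N) (y : 'I_b -> 'I_N),
    injective x /\ injective y /\ (forall i j, x i != y j) /\
    forall i j, c (x i) (y j) = col.

(* Ramsey property for (C_{n_1},...,C_{n_t},K_{m1,m2}) on K_N: colours
   0..t-1 are for the cycles, colour t for K_{m1,m2}. *)
Definition ramsey_prop (t : nat) (n : 'I_t -> nat) (m1 m2 N : nat) : Prop :=
  forall c : coloring N, symmetric_col c -> (forall u v, c u v < t.+1) ->
    (exists i : 'I_t, has_mono_cycle c (n i) i) \/ has_mono_Kab c m1 m2 t.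

(* Main.v *)
Require Import Defs.
From mathcomp Require Import all_boot.
From mathcomp Require Import zify.
Set Implicit Arguments. Unset Strict Implicit. Unset Printing Implicit Defensive.

(** For one cycle colour, take disjoint vertex sets [A], [B] of size at least
    [16 m1 + 24 m2] and [C] of size [m1 + m2 - 1] between which only the cycle
    colour and the last colour occur, and suppose that the last colour has no
    [K_{m1,m2}].  In the cycle-coloured bipartite graph between [A] and [B], large
    sets have large neighbourhoods; after deleting a maximal poorly expanding set,
    all small sets expand as well.  The Friedman-Pippenger argument then embeds,
    disjointly, a path followed by a binary tree from a vertex [u], and a binary
    tree from a vertex [w] on the other side.  The two leaf sets have sizes at
    least [m2] and [m1] and lie on opposite sides, so an edge joins them, which
    gives a path from [u] to [w] of any prescribed odd length.  An edge [uw] closes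
    it to an even cycle, and a vertex of [C] adjacent to both [u] and [w] closes it
    to an odd one.

    With [t = 1], split the [33 m1 + 49 m2] vertices into [A], [B] and [C].  For
    more colours, merge the last two and use induction twice: the first application
    gives a complete bipartite graph in the merged colour, and the second one,
    inside one of its parts, splits this part again, which yields [A], [B], [C]. *)

(** * Friedman-Pippenger growth of paths and binary trees in an expanding relation *)

Section TreeGrowth.

Variables (T : finType) (e : rel T).

Definition nbhd (U : {set T}) : {set T} := [set y | [exists x in U, e x y]].

Lemma nbhdP (U : {set T}) y : reflect (exists2 x, x \in U & e x y) (y \in nbhd U).
Proof. by rewrite inE; apply: exists_inP. Qed.

Lemma nbhdU (U W : {set T}) : nbhd (U :|: W) = nbhd U :|: nbhd W.
Proof.
apply/setP => y; rewrite in_setU; apply/nbhdP/orP.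
  by case=> x; rewrite in_setU => /orP[] xU exy;
    [left | right]; apply/nbhdP; exists x.
by case=> /nbhdP[x xU exy]; exists x; rewrite // in_setU xU ?orbT.
Qed.

Lemma nbhdS (U W : {set T}) : U \subset W -> nbhd U \subset nbhd W.
Proof. by move=> /setUidPr <-; rewrite nbhdU subsetUl. Qed.

Variables (D : {set T}) (m : nat).

(** The Friedman-Pippenger invariant: [S] collects the used or forbidden vertices, and every [u]
    reserves [r u] further neighbours. Testing sets up to size [m.*2] leaves room for the union of
    two sets smaller than [m]. *)
Definition expanding (S : {set T}) (r : T -> nat) :=
  forall U : {set T}, U \subset D -> #|U| <= m.*2 -> \sum_(u in U) r u <= #|nbhd U :\: S|.

(* The sets that expand with no slack are closed under union, by
   submodularity of [U |-> #|nbhd U :\: S|]; if no neighbour of [s] could be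
   used, the largest of them together with [s] would violate [expanding]. *)
Lemma expanding_add S r s :
  expanding S r ->
  (forall U : {set T}, U \subset D -> m <= #|U| <= m.*2 ->
     \sum_(u in U) r u < #|nbhd U :\: S|) ->
  0 < m -> s \in D -> 0 < r s ->
  exists y, [/\ e s y, y \notin S &
    expanding (y |: S) (fun x => if x == s then (r x).-1 else r x)].
Proof.
move=> good large m_gt0 sD rs_gt0.
pose r' x := if x == s then (r x).-1 else r x.
(* Sets containing [s] are left out: for them the demand drops by one, which pays for the loss of
   [y]. *)
pose tight (U : {set T}) :=
  [&& U \subset D, #|U| <= m.*2, #|nbhd U :\: S| <= \sum_(u in U) r u & s \notin U].
have tight_lt U : tight U -> #|U| < m.
  case/and4P=> UD Um tU _; rewrite ltnNge; apply/negP => mU.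
  by have := large U UD; rewrite mU Um => /(_ isT); rewrite ltnNge tU.
have tightU U W : tight U -> tight W -> tight (U :|: W).
  move=> tU tW; have ltU := tight_lt U tU; have ltW := tight_lt W tW.
  case/and4P: tU => UD _ tU sU; case/and4P: tW => WD _ tW sW.
  have UWD : U :|: W \subset D by rewrite subUset UD.
  have cUW : #|U :|: W| <= m.*2 by rewrite cardsU; lia.
  apply/and4P; split => //; last by rewrite in_setU negb_or sU.
  have gI : \sum_(u in U :&: W) r u <= #|nbhd (U :&: W) :\: S|.
    apply: good; first by apply: subset_trans UD; apply: subsetIl.
    by apply: leq_trans (subset_leq_card (subsetIl U W)) _; lia.
  have nI : #|nbhd (U :&: W) :\: S| <= #|(nbhd U :\: S) :&: (nbhd W :\: S)|.
    apply: subset_leq_card; rewrite subsetI !setSD //; apply: nbhdS.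
      exact: subsetIr.
    exact: subsetIl.
  have sumUI : \sum_(u in U :|: W) r u + \sum_(u in U :&: W) r u =
               \sum_(u in U) r u + \sum_(u in W) r u.
    rewrite (big_setID U) /= setUK setDUl setDv set0U.
    rewrite -addnA [X in _ + X]addnC [in RHS](big_setID U (A := W)) /=.
    by rewrite [W :&: U]setIC.
  have := cardsUI (nbhd U :\: S) (nbhd W :\: S).
  by rewrite -setDUl -nbhdU; lia.
have tight0 : tight set0.
  apply/and4P; split; rewrite ?sub0set ?cards0 ?inE // big_set0 leqn0.
  by rewrite cards_eq0 -subset0; apply/subsetP => y /setDP[/nbhdP[x]]; rewrite inE.
have [W tW maxW] : exists2 W, tight W & forall U, tight U -> U \subset W.
  exists [arg max_(W > set0 | tight W) #|W|]; case: arg_maxnP => // W tW maxW.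
  move=> U tU; have /maxW := tightU _ _ tW tU => le_card.
  by apply/setUidPl/esym/eqP; rewrite eqEcard subsetUl.
have [|/existsPn none] := boolP [exists y, [&& e s y, y \notin S &
  [forall U : {set T}, (U \subset D) && (#|U| <= m.*2) ==>
    (\sum_(u in U) r' u <= #|nbhd U :\: (y |: S)|)]]].
  case/existsP=> y /and3P[esy yS /forallP H]; exists y; split=> // U UD Um.
  by have := H U; rewrite UD Um.
exfalso.
(* If a set [U] forbids [y], then [s] is not in [U], [y] is a neighbour of [U] and [U] has no slack,
   so [U] lies in [W]. *)
have cov y : y \in nbhd [set s] :\: S -> y \in nbhd W :\: S.
  case/setDP => /nbhdP[x /set1P -> esy] yS.
  have := none y; rewrite esy yS /= => /forallPn[U].
  rewrite negb_imply -ltnNge => /andP[/andP[UD Um] lt].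
  have gU := good U UD Um.
  have DE : nbhd U :\: (y |: S) = (nbhd U :\: S) :\ y.
    by apply/setP=> z; rewrite !inE negb_or andbA.
  have cD := cardsD1 y (nbhd U :\: S).
  rewrite DE in lt.
  have sum_r' : s \in U -> \sum_(u in U) r u = (\sum_(u in U) r' u).+1.
    move=> sU; rewrite !(bigD1 s sU) /= /r' eqxx -addSn prednK //; congr (_ + _).
    by apply: eq_bigr => z /andP[_ /negPf ->].
  have sU : s \notin U.
    by apply/negP => /sum_r' E; move: cD lt gU; rewrite E; case: (_ \in _) => /=; lia.
  have {sum_r'} sE : \sum_(u in U) r' u = \sum_(u in U) r u.
    apply: eq_bigr => z zU; rewrite /r'; case: eqP => // zs.
    by rewrite -zs zU in sU.
  rewrite sE in lt.
  have yU : y \in nbhd U :\: S.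
    by move: cD lt gU; case: (y \in _) => //=; lia.
  have tU : tight U by apply/and4P; split=> //; move: cD; rewrite yU /=; lia.
  by apply: (subsetP (setSD S (nbhdS (maxW _ tU)))).
(* Adding [s] to [W] gives no new neighbour outside [S] but raises the demand by [r s]. *)
have ltW := tight_lt W tW; case/and4P: tW => WD Wm tW sW.
have := good (s |: W); rewrite subUset sub1set sD WD cardsU1 sW => /(_ isT).
have -> : 1 + #|W| <= m.*2 by lia.
move=> /(_ isT); rewrite big_setU1 //= nbhdU setDUl.
have /setUidPr -> : nbhd [set s] :\: S \subset nbhd W :\: S by apply/subsetP.
by lia.
Qed.

Variable M : nat.
Hypothesis m_gt0 : 0 < m.
Hypothesis large_nbhd : forall U : {set T}, U \subset D -> m <= #|U| -> M <= #|nbhd U|.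

(* [r x] is the number of children that the vertex [x] may still receive. *)
Record growable (S : {set T}) (r : T -> nat) : Prop := Growable {
  growable_le2 : forall x, r x <= 2;
  growable_new : forall x, x \in D -> x \notin S -> r x = 2;
  growable_closed : forall x y, x \in D -> e x y -> y \notin S -> y \in D;
  growable_expanding : expanding S r }.

(** The last clause protects the reservations of all old vertices but the root [s], so that several
    trees can be grown one after the other. *)
Definition extends (S : {set T}) (r : T -> nat) s (S' : {set T}) (r' : T -> nat) k :=
  [/\ growable S' r', S \subset S', #|S'| <= #|S| + k &
      forall x, x \in S -> x != s -> r' x = r x].

(** A set of size between [m] and [m.*2] demands at most [4 * m], and has at least [M] neighbours,
    of which [S] hides fewer than [M - 4 * m]. This is the strict slack required by
    [expanding_add]. *)
Lemma growable_step S r s :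
  growable S r -> #|S| + 4 * m < M -> s \in D -> s \in S -> 0 < r s ->
  exists y r', [/\ extends S r s (y |: S) r' 1, e s y, y \in D, y \notin S &
    r' y = 2 /\ r' s = (r s).-1].
Proof.
move=> [r2 rnew clo good] room sD sS rs_gt0.
have [|y [esy yS good']] := expanding_add good _ m_gt0 sD rs_gt0.
  move=> U UD /andP[mU Um].
  have : \sum_(u in U) r u <= \sum_(u in U) 2 by apply: leq_sum.
  rewrite sum_nat_const => le_sum.
  have := large_nbhd UD mU; have := cardsID S (nbhd U).
  by have := subset_leq_card (subsetIr (nbhd U) S); lia.
have yD := clo _ _ sD esy yS.
have ys : y != s by apply: contraNneq yS => ->.
exists y, (fun x => if x == s then (r x).-1 else r x); split=> //.
- split; rewrite ?subsetUr ?cardsU1 ?yS; [|by []|by lia|by move=> x _ /negPf ->].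
  split=> // [x|x xD|x z xD exz]; first by case: ifP => _; have := r2 x; lia.
    rewrite in_setU1 negb_or => /andP[_ xS].
    by rewrite ifN ?rnew //; apply: contraNneq xS => ->.
  by rewrite in_setU1 negb_or => /andP[_]; apply: clo exz.
- by rewrite (negPf ys) rnew // eqxx.
Qed.

(** Each new vertex comes with two reserved children and the path uses one of them, so its end can
    still be the root of a binary tree. *)
Lemma grow_path p S r s :
  growable S r -> #|S| + p + 4 * m < M -> s \in D -> s \in S -> r s = 2 ->
  exists S' r' q, [/\ extends S r s S' r' p, path e s q, uniq q /\ size q = p,
    {subset q <= S' :\: S} & [/\ last s q \in D, last s q \in S' & r' (last s q) = 2]].
Proof.
elim: p S r s => [|p IH] S r s gr room sD sS rs.
  by exists S, r, [::]; split=> //; split; rewrite ?addn0.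
have [||y [r1 [[gr1 _ c1 f1] esy yD yS [r1y _]]]] := growable_step gr _ sD sS.
- by lia.
- by rewrite rs.
have [||S' [r' [q [[gr' S'S c' f'] pq [uq sq] qS' [lD lS lr]]]]] :=
  IH (y |: S) r1 y gr1 _ yD _ r1y.
- by lia.
- exact: setU11.
exists S', r', (y :: q); split=> //=.
- split=> //; [|by clear -c1 c'; lia|].
    by apply: subset_trans S'S; apply: subsetUr.
  move=> x xS xs; rewrite f' ?f1 // ?in_setU1 ?xS ?orbT //.
  by apply: contraNneq yS => <-.
- by rewrite esy.
- rewrite uq sq andbT; split=> //.
  by apply/negP => /qS'; rewrite !inE eqxx.
- move=> x; rewrite in_cons => /orP[/eqP -> | /qS'].
    by rewrite in_setD yS (subsetP S'S) ?setU11.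
  by rewrite !inE negb_or => /andP[/andP[_ ->] ->].
Qed.

(** Both children of [s] are taken first, then the two subtrees are grown in turn. The tree is
    recorded only through its leaves and a path from the root to each; [2 ^ d.+1 - 2] counts the
    vertices other than the root. *)
Lemma grow_binary_tree d S r s :
  growable S r -> #|S| + 2 ^ d.+1 + 4 * m < M -> s \in D -> s \in S -> r s = 2 ->
  exists S' r' (L : {set T}), [/\ extends S r s S' r' (2 ^ d.+1 - 2), #|L| = 2 ^ d,
    L \subset S' & forall x, x \in L -> exists q,
      [/\ path e s q, last s q = x, uniq q, size q = d & {subset q <= S' :\: S}]].
Proof.
elim: d S r s => [|d IH] S r s gr room sD sS rs.
  exists S, r, [set s]; split; rewrite ?cards1 ?sub1set //.
    by split; rewrite ?leq_addr.
  by move=> x /set1P ->; exists [::].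
have e2 := expnS 2 d.+1; have e1 := expnS 2 d; have e0 := expn_gt0 2 d.
have [||y [r1 [[gr1 _ c1 f1] esy yD yS [r1y r1s]]]] := growable_step gr _ sD sS.
- by lia.
- by rewrite rs.
have [||z [r2 [[gr2 _ c2 f2] esz zD zS [r2z _]]]] := growable_step gr1 _ sD (setU1r y sS).
- by lia.
- by rewrite r1s rs.
have [S2 S2E] : {S2 | S2 = z |: (y |: S)} by exists (z |: (y |: S)).
rewrite -S2E in gr2 c2.
have zy : z != y by apply: contraNneq zS => ->; apply: setU11.
have zS2 : z \in S2 by rewrite S2E setU11.
have yS2 : y \in S2 by rewrite S2E setU1r ?setU11.
have ys : y != s by apply: contraNneq yS => ->.
have r2y : r2 y = 2 by rewrite f2 ?setU11 //.
have [|S3 [r3 [L3 [[gr3 S32 c3 f3] cL3 L3S P3]]]] := IH S2 r2 y gr2 _ yD yS2 r2y.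
  by clear -room c1 c2 e0 e1 e2; lia.
have r3z : r3 z = 2 by rewrite f3.
have [|S4 [r4 [L4 [[gr4 S43 c4 f4] cL4 L4S P4]]]] :=
    IH S3 r3 z gr3 _ zD (subsetP S32 _ zS2) r3z.
  by clear -room c1 c2 c3 e0 e1 e2; lia.
have SS2 : S \subset S2 by rewrite S2E setUA subsetUr.
have S42 := subset_trans S32 S43.
(* A leaf in [L4] lies outside [S3], except when [d] is 0; then the only leaves are [y] and [z]. *)
have disj : [disjoint L3 & L4].
  apply/pred0P => x /=; apply/negP => /andP[xL3 /P4[q [_ lq _ sq qS]]].
  have xS3 := subsetP L3S _ xL3.
  have [q3 [_ l3 _ sq3 _]] := P3 x xL3.
  case: q lq sq qS => [zx d0 _|a q lq _ qS].
    have q3_nil : q3 = [::] by apply/nilP; rewrite /nilp sq3 -d0.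
    by move: l3 zx; rewrite q3_nil /= => <- zx; rewrite zx eqxx in zy.
  have /qS : x \in a :: q by rewrite -lq /= mem_last.
  by rewrite in_setD xS3.
have lift w q (S' S'' : {set T}) : w \in S2 -> w \notin S -> e s w -> S2 \subset S' -> S'' \subset S4 ->
   path e w q -> uniq q -> size q = d -> {subset q <= S'' :\: S'} -> 
   [/\ path e s (w :: q), uniq (w :: q), size (w :: q) = d.+1 & {subset w :: q <= S4 :\: S}].
  move=> wS2 wS esw S'2 S''4 pq uq sq qS; split; rewrite /= ?esw ?uq ?sq ?andbT //.
    by apply/negP => /qS; rewrite in_setD (subsetP S'2 _ wS2).
  move=> x; rewrite in_cons => /orP[/eqP -> | /qS /setDP[xS'' xS']].
    by rewrite in_setD wS (subsetP S42).
  rewrite in_setD (subsetP S''4) // andbT.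
  by apply: contra xS' => xS; rewrite (subsetP S'2) // (subsetP SS2).
exists S4, r4, (L3 :|: L4); split.
- split=> //; first exact: subset_trans SS2 S42.
    by clear -room c1 c2 c3 c4 e0 e1 e2; lia.
  move=> x xS xs; have xS2 := subsetP SS2 _ xS.
  rewrite f4 ?(subsetP S32) //; last by apply: contraNneq zS => <-; apply: setU1r.
  rewrite f3 //; last by apply: contraNneq yS => <-.
  by rewrite f2 ?f1 // setU1r.
- by rewrite cardsU disjoint_setI0 // cards0 cL3 cL4 subn0 addnn e1 mul2n.
- by rewrite subUset L4S (subset_trans L3S).
move=> x /setUP[/P3|/P4] [q [pq lq uq sq qS]].
  have [] := lift y q S2 S3 => //; by exists (y :: q).
have zS' : z \notin S by apply: contra zS => ?; rewrite setU1r.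
have [] := lift z q S3 S4 => //; by exists (z :: q).
Qed.

End TreeGrowth.

(** * Removal of a maximal poorly expanding set *)

(** Large sets expand, so a poor set has fewer than [m] elements. If a small [U] outside a largest
    poor [R] violated the bound, [R :|: U] would be a larger poor set. The strict factor 3 leaves a
    factor 2 after two more vertices are forbidden. *)
Lemma expanding_core (T : finType) (e : rel T) (D : {set T}) (m M : nat) :
  0 < m -> 8 * m < M ->
  (forall U : {set T}, U \subset D -> m <= #|U| -> M <= #|nbhd e U|) ->
  exists R : {set T}, [/\ R \subset D, #|R| < m &
    forall U : {set T}, U \subset D :\: R -> 0 < #|U| <= m.*2 ->
      3 * #|U| < #|nbhd e U :\: R|].
Proof.
move=> m_gt0 mM large.
pose poor (R : {set T}) :=
  [&& R \subset D, #|R| <= m.*2 & #|nbhd e R :\: R| <= 3 * #|R|].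
have cardD (U R : {set T}) : #|nbhd e U| <= #|nbhd e U :\: R| + #|R|.
  have := cardsID R (nbhd e U).
  by have := subset_leq_card (subsetIr (nbhd e U) R); clear; lia.
have poor_lt R : poor R -> #|R| < m.
  case/and3P=> RD Rm pR; rewrite ltnNge; apply/negP => mR.
  by have := large R RD mR; have := cardD R R; clear -mM Rm pR; lia.
have poor0 : poor set0.
  apply/and3P; split; rewrite ?sub0set ?cards0 // leqn0 cards_eq0 -subset0.
  by apply/subsetP => y /setDP[/nbhdP[x]]; rewrite inE.
have [R pR maxR] : exists2 R, poor R & forall U, poor U -> #|U| <= #|R|.
  by exists [arg max_(R > set0 | poor R) #|R|]; case: arg_maxnP.
have ltR := poor_lt _ pR; case/and3P: pR => RD _ pR.
exists R; split=> // U; rewrite subsetD => /andP[UD disj] /andP[U_gt0 Um].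
have [mU|Ult] := leqP m #|U|.
  by have := large U UD mU; have := cardD U R; clear -mM Um ltR; lia.
rewrite ltnNge; apply/negP => pU.
have cRU : #|R :|: U| = #|R| + #|U|.
  by rewrite cardsU setIC disjoint_setI0 // cards0 subn0.
have : poor (R :|: U).
  apply/and3P; split; rewrite ?subUset ?RD ?UD // ?cRU; first by clear -ltR Ult; lia.
  have : #|nbhd e (R :|: U) :\: (R :|: U)| <=
         #|(nbhd e R :\: R) :|: (nbhd e U :\: R)|.
    apply: subset_leq_card; rewrite nbhdU -setDUl; apply: setDS; exact: subsetUl.
  have := cardsUI (nbhd e R :\: R) (nbhd e U :\: R).
  by clear -pR pU; lia.
by move/maxR; rewrite cRU; clear -U_gt0; lia.
Qed.

(** Absence of a complete bipartite graph in the other colour, with the part of size [m1] in [P].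
    The notion is not symmetric in [P] and [Q], so both orders occur below. *)
Definition joined (T : finType) (e : rel T) m1 m2 (P Q : {set T}) :=
  forall X Y : {set T}, X \subset P -> Y \subset Q -> m1 <= #|X| -> m2 <= #|Y| ->
    exists x y, [/\ x \in X, y \in Y & e x y].

Lemma joined_nbhd (T : finType) (e e' : rel T) m1 m2 (P Q X : {set T}) :
  joined e m1 m2 P Q -> {in P & Q, forall x y, e x y -> e' x y} ->
  X \subset P -> m1 <= #|X| -> #|Q| < #|nbhd e' X| + m2.
Proof.
move=> jPQ ee' XP mX; rewrite ltnNge; apply/negP => le_card.
have [|x [y [xX /setDP[yQ /negP yN] exy]]] :=
    jPQ X (Q :\: nbhd e' X) XP (subsetDl _ _) mX.
  have := cardsID (nbhd e' X) Q.
  by have := subset_leq_card (subsetIr Q (nbhd e' X)); clear -le_card; lia.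
by apply: yN; apply/nbhdP; exists x => //; apply: ee' => //; apply: (subsetP XP).
Qed.

(** * Paths of prescribed odd length between the two sides of a bipartite graph *)

Section Bipartite.

Variables (T : finType) (e : rel T) (A B : {set T}) (m1 m2 : nat).
Hypothesis e_sym : symmetric e.
Hypothesis disjAB : [disjoint A & B].
Hypothesis m1_gt0 : 0 < m1.
Hypotheses (cardA : 16 * m1 + 24 * m2 <= #|A|) (cardB : 16 * m1 + 24 * m2 <= #|B|).
Hypotheses (jAB : joined e m1 m2 A B) (jBA : joined e m1 m2 B A).

Definition bip x y :=
  e x y && ((x \in A) && (y \in B) || (x \in B) && (y \in A)).

Lemma bip_sym : symmetric bip.
Proof.
by move=> x y; rewrite /bip e_sym orbC; congr (_ && (_ || _)); apply: andbC.
Qed.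

(** By pigeonhole [U] has [m1] vertices on one side, and these miss fewer than [m2] vertices of the
    other. *)
Lemma bip_large_nbhd (U : {set T}) :
  U \subset A :|: B -> m1.*2 <= #|U| -> 16 * m1 + 23 * m2 < #|nbhd bip U|.
Proof.
move=> UAB mU.
have cU : #|U| <= #|U :&: A| + #|U :&: B|.
  have {1}-> : U = (U :&: A) :|: (U :&: B) by rewrite -setIUr; apply/esym/setIidPl.
  by rewrite cardsU leq_subr.
have [mUA|ltUA] := leqP m1 #|U :&: A|.
  have lt := joined_nbhd (e' := bip) jAB _ (subsetIr U A) mUA.
  have := subset_leq_card (nbhdS bip (subsetIl U A)).
  move: lt; have ee : {in A & B, forall x y, e x y -> bip x y}.
    by move=> x y xA yB exy; rewrite /bip exy xA yB.
  by move=> /(_ ee); clear -cardB; lia.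
have mUB : m1 <= #|U :&: B| by clear -cU ltUA mU; lia.
have lt := joined_nbhd (e' := bip) jBA _ (subsetIr U B) mUB.
have := subset_leq_card (nbhdS bip (subsetIl U B)).
move: lt; have ee : {in B & A, forall x y, e x y -> bip x y}.
  by move=> x y xB yA exy; rewrite /bip exy xB yA orbT.
by move=> /(_ ee); clear -cardA; lia.
Qed.

Lemma notin_side x : x \in A :|: B -> (x \in B) = (x \notin A).
Proof.
rewrite in_setU; have [xA _|//] := boolP (x \in A).
by rewrite (disjointFr disjAB xA).
Qed.

Lemma bip_edge x y : bip x y ->
  [/\ x \in A :|: B, y \in A :|: B & (y \in A) = (x \notin A)].
Proof.
rewrite /bip !in_setU => /andP[_ /orP[] /andP[xs ys]]; rewrite xs ys ?orbT; split=> //.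
  by rewrite (disjointFl disjAB ys).
by rewrite (disjointFl disjAB xs).
Qed.

Lemma bip_path_side x q : path bip x q -> x \in A :|: B ->
  {subset q <= A :|: B} /\ (last x q \in A) = (x \in A) (+) odd (size q).
Proof.
elim: q x => [|y q IH] x /=; first by rewrite addbF.
case/andP=> /bip_edge[_ yAB yA] /IH/(_ yAB)[qAB lA] _; split.
  by move=> z; rewrite in_cons => /orP[/eqP -> | /qAB].
by rewrite lA yA addNb addbN.
Qed.

(** The path has [p] steps from [u], [d2] down its tree, one edge between leaves, and [d1] back up
    to [w]. In total at most [14 * m1 + 5 * m2] vertices are occupied or kept in reserve, within the
    bound of [bip_large_nbhd]. *)
Lemma bip_connect : exists R : {set T}, [/\ R \subset A :|: B, #|R| < m1.*2 &
  forall u w d1 d2 l, u \in (A :|: B) :\: R -> w \in (A :|: B) :\: R ->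
    (u \in A) != (w \in A) ->
    m1 <= 2 ^ d1 <= m1.*2 -> m2 <= 2 ^ d2 <= m2.*2 ->
    odd l -> d1 + d2 < l <= m2 ->
    exists q, [/\ path bip u q, last u q = w, uniq (u :: q) & size q = l]].
Proof.
have m_gt0 : 0 < m1.*2 by rewrite double_gt0.
have [|R [RAB cR expR]] := expanding_core m_gt0 _ bip_large_nbhd.
  by clear; lia.
exists R; split=> // u w d1 d2 l uD wD uw /andP[lo1 hi1] /andP[lo2 hi2] l_odd /andP[dl lm].
set D := _ :\: R in expR uD wD *.
have uNw : u != w by apply: contraNneq uw => ->.
have [S0 S0E] : {S0 | S0 = u |: (w |: R)} by exists (u |: (w |: R)).
have cS0 : #|S0| <= #|R| + 2.
  by rewrite S0E !cardsU1; do 2!case: (_ \notin _); clear; lia.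
have large (U : {set T}) : U \subset D -> m1.*2 <= #|U| ->
    16 * m1 + 23 * m2 < #|nbhd bip U|.
  by move=> UD; apply: bip_large_nbhd; apply: subset_trans UD (subsetDl _ _).
have gr0 : growable bip D m1.*2 S0 (fun=> 2).
  split=> // [x y xD exy|U UD Um].
    rewrite S0E !inE !negb_or => /and3P[_ _ ->] /=.
    by have [_] := bip_edge exy; rewrite in_setU => ->.
  (* Forbidding [u] and [w] costs at most two neighbours, and [3 * #|U| + 1 - 2] is at least
     [2 * #|U|] for nonempty [U]. *)
  rewrite sum_nat_const; have [->|U_gt0] := posnP #|U|; first by [].
  have := expR U UD; rewrite U_gt0 Um => /(_ isT).
  have := cardsU [set u; w] (nbhd bip U :\: S0); rewrite cards2 uNw.
  have : nbhd bip U :\: R \subset [set u; w] :|: (nbhd bip U :\: S0).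
    apply/subsetP => x; rewrite S0E !inE; case: (x == u) => //=; by case: (x == w).
  by move/subset_leq_card; clear -U_gt0; lia.
have uS0 : u \in S0 by rewrite S0E setU11.
have wS0 : w \in S0 by rewrite S0E setU1r ?setU11.
have e1 := expnS 2 d1; have e2 := expnS 2 d2.
have [p lE] : {p | l = (p + d2 + d1).+1}.
  by exists (l - (d2 + d1).+1); clear -dl; lia.
have [||S1 [r1 [q0 [[gr1 S01 c1 f1] pq0 [uq0 sq0] q0S [bD bS rb]]]]] :=
  grow_path m_gt0 large (p := p) gr0 _ uD uS0.
- by clear -m1_gt0 cR cS0 lm lE; lia.
- by [].
(* The tree below the path end spends the reservations of its root, so this root must differ from
   [w]. *)
have bNw : w != last u q0.
  have := mem_last u q0; rewrite in_cons => /orP[/eqP -> | /q0S /setDP[_ bS0]].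
    by rewrite eq_sym.
  by apply: contraNneq bS0 => <-.
have wS1 := subsetP S01 _ wS0.
have [|S2 [r2 [L2 [[gr2 S12 c2 f2] cL2 L2S P2]]]] :=
  grow_binary_tree m_gt0 large (d := d2) gr1 _ bD bS rb.
  by clear -m1_gt0 cR cS0 lm lE c1 e2 hi2; lia.
have r2w : r2 w = 2 by rewrite f2 // f1 // eq_sym.
have wS2 := subsetP S12 _ wS1.
have [|S3 [r3 [L1 [_ cL1 L1S P1]]]] :=
  grow_binary_tree m_gt0 large (d := d1) gr2 _ wD wS2 r2w.
  by clear -m1_gt0 cR cS0 lm lE c1 c2 e1 e2 hi1 hi2; lia.
have DAB x : x \in D -> x \in A :|: B by case/setDP.
have side1 x : x \in L1 -> x \in A :|: B /\ (x \in A) = (w \in A) (+) odd d1.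
  move=> /P1[q [pq lq _ sq _]].
  have [qAB] := bip_path_side pq (DAB _ wD); rewrite lq sq; split=> //.
  rewrite -lq; have := mem_last w q; rewrite in_cons => /orP[/eqP -> | /qAB //].
  exact: DAB.
have side2 y : y \in L2 -> y \in A :|: B /\ (y \in A) = (u \in A) (+) odd (p + d2).
  move=> /P2[q [pq lq _ sq _]].
  have pqq : path bip u (q0 ++ q) by rewrite cat_path pq0.
  have [qAB] := bip_path_side pqq (DAB _ uD).
  rewrite last_cat lq size_cat sq0 sq; split=> //.
  rewrite -lq -last_cat; have := mem_last u (q0 ++ q).
  by rewrite in_cons => /orP[/eqP -> | /qAB //]; apply: DAB.
(* [u] and [w] are on opposite sides and [p + d2 + d1] is even, so the two leaf sets are on opposite
   sides too. *)
have opposite : (u \in A) (+) odd (p + d2) = ~~ ((w \in A) (+) odd d1).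
  move: l_odd uw; rewrite lE /= oddD.
  by case: (u \in A); case: (w \in A); case: (odd (p + d2)); case: (odd d1).
have [x [y [xL1 yL2 exy]]] : exists x y, [/\ x \in L1, y \in L2 & e x y].
  have [wA|wA] := boolP ((w \in A) (+) odd d1).
    apply: jAB; rewrite ?cL1 ?cL2 //; apply/subsetP => x.
      by case/side1=> _ ->.
    by case/side2=> xAB xA; rewrite notin_side // xA opposite wA.
  apply: jBA; rewrite ?cL1 ?cL2 //; apply/subsetP => x.
    by case/side1=> xAB xA; rewrite notin_side // xA.
  by case/side2=> _ ->; rewrite opposite.
have {}exy : bip y x.
  have [xAB xA] := side1 _ xL1; have [yAB yA] := side2 _ yL2.
  rewrite /bip e_sym exy /= !notin_side // xA yA opposite.
  by case: (_ (+) _).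
have [q1 [pq1 lq1 uq1 sq1 q1S]] := P1 _ xL1.
have [q2 [pq2 lq2 uq2 sq2 q2S]] := P2 _ yL2.
have revE : rev (w :: q1) = x :: rev (belast w q1) by rewrite lastI lq1 rev_rcons.
exists ((q0 ++ q2) ++ rev (w :: q1)); split.
- rewrite cat_path cat_path pq0 pq2 last_cat lq2 revE /= exy -lq1 rev_path.
  by rewrite (eq_path (e' := bip)) // => a b; apply: bip_sym.
- by rewrite rev_cons last_cat last_rcons.
(* Disjointness follows from the order of growth: [u] and [w] are in [S0], [q0] and [q2] in [S2]
   outside [S0], and [q1] outside [S2]. *)
- have q02S z : z \in q0 ++ q2 -> z \in S2 /\ z \notin S0.
    rewrite mem_cat => /orP[/q0S|/q2S] /setDP[zS zS']; split=> //.
      exact: (subsetP S12).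
    by apply: contra zS'; apply: (subsetP S01).
  have q1S' z : z \in q1 -> z \notin S2 by case/q1S/setDP.
  rewrite -cat_cons cat_uniq rev_uniq /= uq1 andbT cat_uniq uq0 uq2 andbT.
  apply/and3P; split.
  + apply/andP; split; first by apply/negP => /q02S[_]; rewrite uS0.
    by rewrite andTb; apply/hasPn => z /q2S/setDP[_]; apply: contra => /q0S/setDP[].
  + apply/hasPn => z; rewrite mem_rev !in_cons negb_or => /orP[/eqP -> | zq1].
      rewrite eq_sym uNw; apply/negP => /q02S[_]; by rewrite wS0.
    have zS2 := q1S' _ zq1; apply/andP; split.
      by apply: contraNneq zS2 => ->; apply: (subsetP S12); apply: (subsetP S01).
    by apply: contra zS2 => /q02S[].
  + by apply/negP => /q1S'; rewrite wS2.
- by rewrite !size_cat size_rev /= sq0 sq1 sq2 lE; clear; lia.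
Qed.

End Bipartite.

(** * Even and odd cycles in a tripartite configuration *)

Lemma tripartite_cycle (T : finType) (e : rel T) (A B C : {set T}) m1 m2 d1 d2 n :
  symmetric e -> [disjoint A & B] -> [disjoint A & C] -> [disjoint B & C] ->
  0 < m1 -> 0 < m2 ->
  16 * m1 + 24 * m2 <= #|A| -> 16 * m1 + 24 * m2 <= #|B| -> m1 + m2 - 1 <= #|C| ->
  joined e m1 m2 A B -> joined e m1 m2 B A -> joined e m1 m2 C B ->
  joined e m1 m2 A C ->
  m1 <= 2 ^ d1 <= m1.*2 -> m2 <= 2 ^ d2 <= m2.*2 -> d1 + d2 + 3 <= n <= m2 ->
  exists s, [/\ size s = n, uniq s & cycle e s].
Proof.
move=> e_sym dAB dAC dBC m1_gt0 m2_gt0 cA cB cC jAB jBA jCB jAC h1 h2 /andP[dn nm].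
have [R [RAB cR conn]] := bip_connect e_sym dAB m1_gt0 cA cB jAB jBA.
have be x y : bip e A B x y -> e x y by case/andP.
have cardDR (P : {set T}) : 16 * m1 + 24 * m2 <= #|P| -> m1 + m2 <= #|P :\: R|.
  have := cardsID R P; have := subset_leq_card (subsetIr P R).
  by clear -cR; lia.
have sA x : x \in A -> x \in A :|: B by rewrite in_setU => ->.
have sB x : x \in B -> x \in A :|: B by rewrite in_setU orbC => ->.
have AB x y : x \in A :\: R -> y \in B :\: R ->
    [/\ x \in (A :|: B) :\: R, y \in (A :|: B) :\: R & (x \in A) != (y \in A)].
  case/setDP=> xA xR /setDP[yB yR]; rewrite !in_setD xR yR sA ?sB //.
  by rewrite xA (disjointFl dAB yB).
have [n_odd|n_even] := boolP (odd n).
  (* At most [m1 - 1] vertices of [C] have no neighbour in [B :\: R] and at most [m2 - 1] have none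
     in [A :\: R], so among [m1 + m2 - 1] one has both. *)
  pose X := [set v in C | v \notin nbhd e (B :\: R)].
  pose Y := [set v in C | v \notin nbhd e (A :\: R)].
  have cX : #|X| < m1.
    rewrite ltnNge; apply/negP => mX.
    have [||||x [y [xX yB exy]]] := jCB X (B :\: R).
    + by apply/subsetP => v; rewrite inE => /andP[].
    + exact: subsetDl.
    + exact: mX.
    + by have := cardDR _ cB; clear; lia.
    by move: xX; rewrite inE => /andP[_ /negP[]]; apply/nbhdP; exists y => //; rewrite e_sym.
  have cY : #|Y| < m2.
    rewrite ltnNge; apply/negP => mY.
    have [||||x [y [xA yY exy]]] := jAC (A :\: R) Y.
    + exact: subsetDl.
    + by apply/subsetP => v; rewrite inE => /andP[].
    + by have := cardDR _ cA; clear; lia.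
    + exact: mY.
    by move: yY; rewrite inE => /andP[_ /negP[]]; apply/nbhdP; exists x.
  have : ~~ (C \subset X :|: Y).
    apply/negP => /subset_leq_card; rewrite cardsU.
    by clear -cX cY cC; lia.
  case/subsetPn=> v vC; rewrite in_setU ![_ \in [set _ in _ | _]]inE vC negb_or !negbK.
  case/andP=> /nbhdP[w wB ewv] /nbhdP[u uA euv].
  have [uD wD uw] := AB _ _ uA wB.
  have [||q [pq lq uq sq]] := conn u w d1 d2 (n - 2) uD wD uw h1 h2.
  + by rewrite oddB ?n_odd //; clear -dn; lia.
  + by clear -dn nm; lia.
  have uAB : u \in A :|: B by case/setDP: uD.
  have [qAB _] := bip_path_side dAB pq uAB.
  have vNAB : v \notin A :|: B.
    by rewrite in_setU (disjointFl dAC vC) (disjointFl dBC vC).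
  exists (v :: u :: q); split.
  + by rewrite /= sq; clear -dn; lia.
  + rewrite cons_uniq uq andbT in_cons negb_or; apply/andP; split.
      by apply: contraNneq vNAB => ->.
    by apply: contra vNAB => /qAB.
  + by rewrite /= rcons_path lq ewv e_sym euv (sub_path be pq).
have [||||u [w [uA wB euw]]] := jAB (A :\: R) (B :\: R).
- exact: subsetDl.
- exact: subsetDl.
- by have := cardDR _ cA; clear; lia.
- by have := cardDR _ cB; clear; lia.
have [uD wD uw] := AB _ _ uA wB.
have [||q [pq lq uq sq]] := conn u w d1 d2 n.-1 uD wD uw h1 h2.
- by move: n_even dn; clear; case: n => [|n] //=; rewrite ?negbK //; lia.
- by clear -dn nm; lia.
exists (u :: q); split=> //; first by rewrite /= sq; clear -dn; lia.
by rewrite /= rcons_path lq e_sym euw (sub_path be pq).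
Qed.

(** * From sets and relations to colourings *)

Lemma cycle_has_mono_cycle N (c : coloring N) n col (s : seq 'I_N) :
  size s = n -> uniq s -> cycle (fun x y => c x y == col) s ->
  has_mono_cycle c n col.
Proof.
move=> <-{n} us cs; exists (tnth (in_tuple s)); split.
  exact/tuple_uniqP.
case: s us cs => [|x s] _ /=; first by move=> _ [].
move=> cs j; move/(pathP x): cs => /(_ j).
rewrite size_rcons => /(_ (ltn_ord j)) /eqP; rewrite !(tnth_nth x) /=.
rewrite -rcons_cons !nth_rcons /= ltn_ord => E.
(* At the last index [ordS] wraps around to 0, which matches the copy of [x] appended by [cycle]. *)
have := ltn_ord j; rewrite /= ltnS leq_eqVlt => /orP[/eqP js|lt].
  by move: E; rewrite js modnn ltnn eqxx.
by move: E; rewrite lt modn_small.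
Qed.

Lemma joined_or_mono_Kab N (c : coloring N) a b m1 m2 (P Q : {set 'I_N}) :
  [disjoint P & Q] -> {in P & Q, forall x y, c x y = a \/ c x y = b} ->
  joined (fun x y => c x y == a) m1 m2 P Q \/ has_mono_Kab c m1 m2 b.
Proof.
move=> dPQ cPQ.
have [/existsP[X /existsP[Y]] | none] := boolP [exists X : {set 'I_N},
  [exists Y : {set 'I_N}, [&& X \subset P, Y \subset Q, m1 <= #|X|, m2 <= #|Y| &
   [forall x in X, forall y in Y, c x y != a]]]].
  case/and5P=> XP YQ mX mY /forall_inP noa; right.
  exists (fun i => enum_val (widen_ord mX i)), (fun i => enum_val (widen_ord mY i)).
  split; [|split; [|split]].
  - by move=> i j /enum_val_inj[ij]; apply: val_inj.
  - by move=> i j /enum_val_inj[ij]; apply: val_inj.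
  - move=> i j; have xP := subsetP XP _ (enum_valP (widen_ord mX i)).
    apply: contraTneq xP => ->.
    by rewrite (disjointFl dPQ) // (subsetP YQ) ?enum_valP.
  - move=> i j; have xX := enum_valP (widen_ord mX i).
    have yY := enum_valP (widen_ord mY j).
    have /forall_inP/(_ _ yY) := noa _ xX.
    by case: (cPQ _ _ (subsetP XP _ xX) (subsetP YQ _ yY)) => // ->; rewrite eqxx.
left=> X Y XP YQ mX mY.
have [/exists_inP[x xX /exists_inP[y yY exy]]|nE] :=
  boolP [exists x in X, exists y in Y, c x y == a]; first by exists x, y.
case/negP: none; apply/existsP; exists X; apply/existsP; exists Y.
rewrite XP YQ mX mY /=; apply/forall_inP => x xX; apply/forall_inP => y yY.
apply: contra nE => exy; apply/exists_inP; exists x => //.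
by apply/exists_inP; exists y.
Qed.

(** Supplies the tree depths: a binary tree of depth [up_log 2 m] has at least [m] leaves and at
    most twice as many. *)
Lemma expn_up_log_bounds m : 0 < m -> m <= 2 ^ up_log 2 m <= m.*2.
Proof.
case: m => [|[|m]] // _; rewrite up_logP //=.
have := up_log_gtn (isT : 1 < 2) (isT : 1 < m.+2).
have : 0 < up_log 2 m.+2 by rewrite up_log_gt0.
by case: (up_log 2 m.+2) => //= k _; rewrite expnS; lia.
Qed.

(** The three parts are injective maps because [has_mono_Kab] provides them in this form. The bound
    on [K] makes both tree depths smaller than [up_log 2 K], so cycles of length
    [(up_log 2 K).*2 + 2] are long enough. *)
Lemma tripartite_ramsey N (c : coloring N) a b m1 m2 n K la lb lc
  (xA : 'I_la -> 'I_N) (xB : 'I_lb -> 'I_N) (xC : 'I_lc -> 'I_N) :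
  symmetric_col c -> 0 < m1 -> 0 < m2 ->
  16 * m1 + 24 * m2 <= la -> 16 * m1 + 24 * m2 <= lb -> m1 + m2 - 1 <= lc ->
  injective xA -> injective xB -> injective xC ->
  (forall i j, xA i != xB j) -> (forall i j, xA i != xC j) ->
  (forall i j, xB i != xC j) ->
  (forall i j, c (xA i) (xB j) = a \/ c (xA i) (xB j) = b) ->
  (forall i j, c (xA i) (xC j) = a \/ c (xA i) (xC j) = b) ->
  (forall i j, c (xB i) (xC j) = a \/ c (xB i) (xC j) = b) ->
  (m1 + m2).*2 <= K -> (up_log 2 K).*2 + 2 <= n <= m2 ->
  has_mono_cycle c n a \/ has_mono_Kab c m1 m2 b.
Proof.
move=> c_sym m1_gt0 m2_gt0 lA lB lC iA iB iC nAB nAC nBC cAB cAC cBC mK nP.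
pose im k (x : 'I_k -> 'I_N) := [set x i | i : 'I_k].
have cim k (x : 'I_k -> 'I_N) : injective x -> #|im k x| = k.
  by move=> ix; rewrite card_imset // card_ord.
have dim k l (x : 'I_k -> 'I_N) (y : 'I_l -> 'I_N) :
    (forall i j, x i != y j) -> [disjoint im k x & im l y].
  move=> nxy; apply/pred0P => z /=; apply/negP => /andP[/imsetP[i _ ->]].
  by case/imsetP=> j _ /eqP; rewrite (negPf (nxy i j)).
have colim k l (x : 'I_k -> 'I_N) (y : 'I_l -> 'I_N) :
    (forall i j, c (x i) (y j) = a \/ c (x i) (y j) = b) ->
    {in im k x & im l y, forall u v, c u v = a \/ c u v = b}.
  by move=> cxy _ _ /imsetP[i _ ->] /imsetP[j _ ->].
have [||jAB|] := @joined_or_mono_Kab _ c a b m1 m2 (im _ xA) (im _ xB); [| | |by right].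
- exact: dim.
- exact: colim.
have [||jBA|] := @joined_or_mono_Kab _ c a b m1 m2 (im _ xB) (im _ xA); [| | |by right].
- by rewrite disjoint_sym; apply: dim.
- by apply: colim => i j; rewrite c_sym.
have [||jCB|] := @joined_or_mono_Kab _ c a b m1 m2 (im _ xC) (im _ xB); [| | |by right].
- by rewrite disjoint_sym; apply: dim.
- by apply: colim => i j; rewrite c_sym.
have [||jAC|] := @joined_or_mono_Kab _ c a b m1 m2 (im _ xA) (im _ xC); [| | |by right].
- exact: dim.
- exact: colim.
left.
have logK m : 0 < m -> m.*2 <= K -> up_log 2 m < up_log 2 K.
  by move=> m_gt0 mKK; rewrite -up_log2_double // leq_up_log.
have l1 : up_log 2 m1 < up_log 2 K by apply: logK => //; clear -mK; lia.
have l2 : up_log 2 m2 < up_log 2 K by apply: logK => //; clear -mK; lia.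
have e_sym : symmetric (fun x y => c x y == a) by move=> x y; rewrite c_sym.
have [||||s [ss us cs]] := tripartite_cycle (n := n) e_sym (dim _ _ _ _ nAB)
  (dim _ _ _ _ nAC) (dim _ _ _ _ nBC) m1_gt0 m2_gt0 _ _ _ jAB jBA jCB jAC
  (expn_up_log_bounds m1_gt0) (expn_up_log_bounds m2_gt0); rewrite ?cim //.
- by clear -l1 l2 nP; lia.
exact: cycle_has_mono_cycle cs.
Qed.

(** * Induction on the number of cycle colours *)

Lemma f_aux_ge k m1 m2 : (m1 + m2).*2 <= f_aux k m1 m2.
Proof.
elim: k m1 m2 => [|k IH] m1 m2 /=; first by lia.
by apply: leq_trans (IH _ _); lia.
Qed.

Lemma ramsey_f_aux k m1 m2 (n : 'I_k.+1 -> nat) :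
  0 < m1 -> 0 < m2 ->
  (forall i, (up_log 2 (f_aux k m1 m2)).*2 + 2 <= n i <= m2) ->
  ramsey_prop n m1 m2 (f_aux k m1 m2).
Proof.
elim: k m1 m2 n => [|k IH] m1 m2 n m1_gt0 m2_gt0 nP.
  (* Two parts of size [16 * m1 + 24 * m2] and a third of size [m1 + m2] explain the constants 33
     and 49. *)
  have NE : f_aux 0 m1 m2 =
      (16 * m1 + 24 * m2) + (16 * m1 + 24 * m2) + (m1 + m2) by rewrite /=; lia.
  have := nP ord0; rewrite NE => nP0 c c_sym c_lt.
  have c01 u v : c u v = 0 \/ c u v = 1.
    by case: (c u v) (c_lt u v) => [|[|]]; auto.
  set l := 16 * m1 + 24 * m2 in c c_sym c_lt c01 nP0 *.
  have [|||||||||||cyc|K] := @tripartite_ramsey _ c 0 1 m1 m2 (n ord0) (l + l + (m1 + m2))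
    l l (m1 + m2) (fun i => lshift _ (lshift _ i)) (fun i => lshift _ (rshift _ i))
    (fun i => rshift _ i) c_sym m1_gt0 m2_gt0 (leqnn _) (leqnn _) (leq_subr _ _).
  - by move=> i j /lshift_inj/lshift_inj.
  - by move=> i j /lshift_inj/rshift_inj.
  - exact: rshift_inj.
  - by move=> i j; rewrite (inj_eq (@lshift_inj _ _)) eq_lrshift.
  - by move=> i j; rewrite eq_lrshift.
  - by move=> i j; rewrite eq_lrshift.
  - by [].
  - by [].
  - by [].
  - by rewrite /l; clear; lia.
  - exact: nP0.
  - by left; exists ord0.
  - by right.
pose l := 32 * m1 + 49 * m2.
pose a := f_aux k l (m1 + m2 - 1).
have fE : f_aux k.+1 m1 m2 = f_aux k a l by [].
rewrite fE in nP *.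
move=> c c_sym c_lt.
(* Merges the last cycle colour [k.+1] with the bipartite colour [k.+2]. *)
pose c' u v := minn (c u v) k.+1.
have c'_sym : symmetric_col c' by move=> u v; rewrite /c' c_sym.
have c'_lt u v : c' u v < k.+2 by rewrite ltnS geq_minr.
have c'_low u v i : i < k.+1 -> c' u v = i -> c u v = i by rewrite /c'; lia.
have c'_top u v : c' u v = k.+1 -> c u v = k.+1 \/ c u v = k.+2.
  by have := c_lt u v; rewrite /c'; lia.
pose n' (i : 'I_k.+1) := n (widen_ord (leqnSn _) i).
have n'P i := nP (widen_ord (leqnSn k.+1) i).
have l_gt0 : 0 < l by rewrite /l; lia.
have m_gt0 : 0 < m1 + m2 - 1 by lia.
have a_ge := f_aux_ge k l (m1 + m2 - 1); rewrite -/a in a_ge.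
have f_ge := f_aux_ge k a l.
have a_gt0 : 0 < a by lia.
have [|[i [v [iv cv]]]|[x [y [ix [iy [nxy cxy]]]]]] := IH a l n' a_gt0 l_gt0 _ c' c'_sym c'_lt.
- by move=> i; have := n'P i; rewrite /n' /l; lia.
- left; exists (widen_ord (leqnSn _) i), v; split=> // j.
  by apply: c'_low (cv j); apply: ltn_ord.
pose c2 i j := c' (x i) (x j).
have c2_sym : symmetric_col c2 by move=> u v; apply: c'_sym.
(* The second induction step, on the [a] vertices of [x], involves the smaller logarithm of [a], so
   the same cycle lengths remain admissible. *)
have log_le : up_log 2 a <= up_log 2 (f_aux k a l) by apply: leq_up_log; lia.
have [||[i [v [iv cv]]]|[x2 [y2 [ix2 [iy2 [nxy2 cxy2]]]]]] :=
  IH l (m1 + m2 - 1) n' l_gt0 m_gt0 _ c2 c2_sym.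
- by move=> i; have := n'P i; rewrite /n' -/a; lia.
- by move=> u v; apply: c'_lt.
- left; exists (widen_ord (leqnSn _) i), (x \o v); split; first exact: inj_comp.
  by move=> j; apply: c'_low (cv j); apply: ltn_ord.
(* [x \o x2] and [y] have size [l] and serve as [A] and [B]; [x \o y2], of size [m1 + m2 - 1],
   serves as [C]. *)
have [||||||||||cyc|K] := @tripartite_ramsey _ c k.+1 k.+2 m1 m2 (n ord_max) (f_aux k a l)
  _ _ _ (x \o x2) y (x \o y2) c_sym m1_gt0 m2_gt0 _ _ (leqnn _) (inj_comp ix ix2) iy
  (inj_comp ix iy2).
- by rewrite /l; lia.
- by rewrite /l; lia.
- by move=> i j; apply: nxy.
- by move=> i j; rewrite /= (inj_eq ix).
- by move=> i j; rewrite eq_sym; apply: nxy.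
- by move=> i j; apply: c'_top; apply: cxy.
- by move=> i j; apply: c'_top; apply: cxy2.
- by move=> i j; apply: c'_top; rewrite c'_sym; apply: cxy.
- by rewrite /l in f_ge a_ge *; lia.
- exact: nP.
- by left; exists ord_max.
- by right.
Qed.

(* R(C_{n_1},...,C_{n_t},K_{m1,m2}) <= f_t(m1,m2), i.e. the least N with the
   Ramsey property is at most f_t(m1,m2). *)
Theorem theorem2p9 (t m1 m2 : nat) (n : 'I_t -> nat) :
  0 < t -> 0 < m1 -> 0 < m2 ->
  (forall i, 0 < n i) ->
  (forall i, (ceil_log2 (f t m1 m2)).*2 + 2 <= n i <= m2) ->
  exists N, N <= f t m1 m2 /\ ramsey_prop n m1 m2 N.
Proof.
case: t n => // k n _ m1_gt0 m2_gt0 _ nP.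
by exists (f k.+1 m1 m2); split=> //; apply: ramsey_f_aux.
Qed.
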